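(* The observer space $O$ of de Sitter spacetime is isomorphic as a $G$-space, $G=\mathrm{SO}_o(4,1)$, to the space of triples consisting of an ordered pair $(0,\infty)$ of distinct points in $P(\mathcal{C})$ together with a fixed sphere centered at the origin of the resulting conformal vector space $P(\mathcal{C})\setminus\{\infty\}$.
   Context: Let $\mathbb{R}^{4,1}$ be $\mathbb{R}^5$ with the Minkowski inner product $\eta=\mathrm{diag}(-1,1,1,1,1)$, and let $G=\mathrm{SO}_o(4,1)$ be the identity component of its linear isometry group. De Sitter spacetime is $S^{3,1}=\{x\in\mathbb{R}^{4,1}:\eta(x,x)=1\}$, and $\mathrm{H}^4=\{u\in\mathbb{R}^{4,1}:\eta(u,u)=-1,\ u_0>0\}$. The de Sitter observer space is the space of unit future-directed timelike tangent vectors to $S^{3,1}$, i.e. $O=\{(x,u)\in S^{3,1}\times\mathrm{H}^4:\eta(x,u)=0\}$. The projective light cone $P(\mathcal{C})$ is the space of one-dimensional null subspaces of $\mathbb{R}^{4,1}$ (a conformal 3-sphere). $G$ acts on all of these. Conformal vector space determined by an ordered pair. Given distinct points $0=[v]$ and $\infty=[w]$ of $P(\mathcal{C})$ (brackets denote linear span), with nonzero null representatives $v,w$ (so $\eta(v,w)\neq 0$), let $W=[v,w]^\perp$, a 3-dimensional subspace on which $\eta$ is positive definite. The map $W\to P(\mathcal{C})\setminus\{\infty\}$, $s\mapsto\left[v+s-\frac{\eta(s,s)}{2\eta(v,w)}w\right]$, is a bijection sending $0\in W$ to the point $0=[v]$; changing the representatives $v,w$ only changes it by precomposition with a nonzero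 scalar multiplication on $W$. This makes $P(\mathcal{C})\setminus\{\infty\}$ a conformal vector space, i.e. a 3-dimensional Euclidean vector space up to scale, with origin the point $0$. A sphere centered at the origin is the image of $\{s\in W:\eta(s,s)=r^2\}$ for some $r>0$. All spaces involved are homogeneous $G$-spaces, with manifold structure that of $G$ modulo a closed stabilizer; ''isomorphic as a $G$-space'' means there is a $G$-equivariant diffeomorphism. *)

(* Defs.v *)
From HB Require Import structures.
From mathcomp Require Import all_boot all_order all_algebra.
From mathcomp Require Import all_classical all_reals all_analysis.

Set Implicit Arguments.
Unset Strict Implicit.
Unset Printing Implicit Defensive.
Import Order.TTheory GRing.Theory Num.Theory.
Import numFieldNormedType.Exports.

Local Open Scope classical_set_scope.
Local Open Scope ring_scope.

Definition eta_mx (R : realType) : 'M[R]_5 :=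
  diag_mx (\row_(i < 5) (if i == ord0 then -1 else 1)).

Definition eta (R : realType) (x y : 'cV[R]_5) : R :=
  (x^T *m @eta_mx R *m y) ord0 ord0.

Definition isometries (R : realType) : set 'M[R]_5 :=
  [set A | forall x y : 'cV[R]_5, eta (A *m x) (A *m y) = eta x y].

(* SO_o(4,1); the topology is the one induced by the normed space of 5 x 5
   matrices. *)
Definition SOo41 (R : realType) : set 'M[R]_5 :=
  connected_component (@isometries R) 1%:M.

(* f is n times differentiable on the open set U, all directional derivatives
   of order n being continuous on U. *)
Fixpoint Ck (R : realType) (V : normedModType R) (n : nat) (U : set V)
    (f : V -> R) : Prop :=
  if n is m.+1 then
    (forall x, U x -> differentiable f x) /\
    (forall v : V, Ck m U (fun x => 'D_v f x))
  else forall x, U x -> {for x, continuous f}.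

Definition Cinfty (R : realType) (V : normedModType R) (U : set V)
    (f : V -> R) : Prop := forall n, Ck n U f.

Definition open_in_G (R : realType) (D : set 'M[R]_5) : Prop :=
  exists2 U : set 'M[R]_5, open U & D = U `&` @SOo41 R.

(* Smoothness on an open subset D of G, as an embedded submanifold of the space
   of matrices: near each point, the restriction of a smooth function of the
   matrix entries. *)
Definition smooth_in_G (R : realType) (D : set 'M[R]_5) (F : 'M[R]_5 -> R) :
    Prop :=
  forall g, D g -> exists (U : set 'M[R]_5) (f : 'M[R]_5 -> R),
    [/\ open U, U g, Cinfty U f & forall h, U h -> D h -> F h = f h].

(* Only the values of gact for g in G and x in gcar matter. *)
Record Gspace (R : realType) : Type := MkGspace {
  gtype : Type ;
  gcar : set gtype ;
  gact : 'M[R]_5 -> gtype -> gtype }.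
Arguments gcar {R} g _.

Record homogeneous (R : realType) (X : Gspace R) : Prop := MkHomogeneous {
  hom_nonempty : exists x, gcar X x ;
  hom_stable : forall g x, SOo41 g -> gcar X x -> gcar X (gact g x) ;
  hom_act1 : forall x, gcar X x -> gact 1%:M x = x ;
  hom_actM : forall g h x, SOo41 g -> SOo41 h -> gcar X x ->
    gact (g *m h) x = gact g (gact h x) ;
  hom_transitive : forall x y, gcar X x -> gcar X y ->
    exists2 g, SOo41 g & gact g x = y ;
  hom_closed_stab : forall x, gcar X x ->
    closed [set g : 'M[R]_5 | SOo41 g /\ gact g x = x] }.

Definition orbit_preimage (R : realType) (X : Gspace R) (x : gtype X)
    (U : set (gtype X)) : set 'M[R]_5 :=
  [set g | SOo41 g /\ U (gact g x)].

(* The manifold structure of G / G_x transported to X by g G_x |-> g x: the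
   quotient topology, with the sheaf of functions whose pullback along the
   submersion G -> G / G_x is smooth.  Quantifying over all base points x is
   harmless, since right translations are diffeomorphisms of G. *)
Definition open_in (R : realType) (X : Gspace R) (U : set (gtype X)) : Prop :=
  U `<=` gcar X /\ forall x, gcar X x -> open_in_G (orbit_preimage x U).

Definition smooth_fun_on (R : realType) (X : Gspace R) (U : set (gtype X))
    (f : gtype X -> R) : Prop :=
  forall x, gcar X x -> smooth_in_G (orbit_preimage x U) (fun g => f (gact g x)).

(* Smooth maps are morphisms of locally ringed spaces: continuous, and pulling
   back locally defined smooth functions to smooth functions. *)
Definition smooth_map (R : realType) (X Y : Gspace R)
    (phi : gtype X -> gtype Y) : Prop :=
  forall (V : set (gtype Y)) (f : gtype Y -> R),
    open_in V -> smooth_fun_on V f ->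
    open_in (gcar X `&` phi @^-1` V) /\
    smooth_fun_on (gcar X `&` phi @^-1` V) (f \o phi).

Definition diffeomorphism (R : realType) (X Y : Gspace R)
    (phi : gtype X -> gtype Y) : Prop :=
  exists psi : gtype Y -> gtype X,
    [/\ forall x, gcar X x -> gcar Y (phi x) /\ psi (phi x) = x,
        forall y, gcar Y y -> gcar X (psi y) /\ phi (psi y) = y,
        smooth_map phi & smooth_map psi].

Definition equivariant (R : realType) (X Y : Gspace R)
    (phi : gtype X -> gtype Y) : Prop :=
  forall g x, SOo41 g -> gcar X x -> phi (gact g x) = gact g (phi x).

Definition Gspace_isomorphic (R : realType) (X Y : Gspace R) : Prop :=
  exists phi : gtype X -> gtype Y, diffeomorphism phi /\ equivariant phi.

Definition deSitter (R : realType) : set 'cV[R]_5 := [set x | eta x x = 1].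

Definition H4 (R : realType) : set 'cV[R]_5 :=
  [set u | eta u u = -1 /\ 0 < u ord0 ord0].

Definition observers (R : realType) : set ('cV[R]_5 * 'cV[R]_5) :=
  [set xu | [/\ deSitter xu.1, H4 xu.2 & eta xu.1 xu.2 = 0]].

Definition observer_space (R : realType) : Gspace R :=
  MkGspace (@observers R) (fun g xu => (g *m xu.1, g *m xu.2)).

Definition PC (R : realType) : set {vspace 'cV[R]_5} :=
  [set p | \dim p = 1%N /\ forall x, x \in p -> eta x x = 0].

Definition act_line (R : realType) (g : 'M[R]_5) (p : {vspace 'cV[R]_5}) :
    {vspace 'cV[R]_5} :=
  (linfun (mulmx g : 'cV[R]_5 -> 'cV[R]_5) @: p)%VS.

Definition W_perp (R : realType) (v w : 'cV[R]_5) : set 'cV[R]_5 :=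
  [set s | eta v s = 0 /\ eta w s = 0].

Definition conf_chart (R : realType) (v w s : 'cV[R]_5) : {vspace 'cV[R]_5} :=
  <[ v + s - (eta s s / (2 * eta v w)) *: w ]>%VS.

Definition sphere_of (R : realType) (v w : 'cV[R]_5) (r : R) :
    set {vspace 'cV[R]_5} :=
  conf_chart v w @` [set s | W_perp v w s /\ eta s s = r ^+ 2].

(* The sphere has no preferred radius: rescaling the representatives v, w of
   zero and infinity rescales r. *)
Definition centered_sphere (R : realType) (zero infty : {vspace 'cV[R]_5})
    (S : set {vspace 'cV[R]_5}) : Prop :=
  exists (v w : 'cV[R]_5) (r : R),
    [/\ v != 0 /\ w != 0, zero = <[v]>%VS, infty = <[w]>%VS, 0 < r &
        S = sphere_of v w r].

Definition pointed_spheres (R : realType) :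
    set ({vspace 'cV[R]_5} * {vspace 'cV[R]_5} * set {vspace 'cV[R]_5}) :=
  [set t | [/\ PC t.1.1, PC t.1.2, t.1.1 <> t.1.2 &
               centered_sphere t.1.1 t.1.2 t.2]].

Definition sphere_space (R : realType) : Gspace R :=
  MkGspace (@pointed_spheres R)
    (fun g t => (act_line g t.1.1, act_line g t.1.2, act_line g @` t.2)).

(* Main.v *)
(* For an observer (x, u) the vectors u + x and u - x are null, with product -2,
   so their lines are an ordered pair (zero, infinity) with a distinguished
   scale.  With these representatives the sphere of radius 2 consists of the
   lines [u + s], s a unit vector orthogonal to x and u: the observer's celestial
   equator.  Conversely, rescaling v moves the radius of a centered sphere to 2
   and rescaling w makes the product -2; the remaining common sign of v and w is
   fixed by requiring (v + w) / 2 to be future-directed.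

   As the manifold structures are quotient structures of G, an equivariant
   bijection is automatically a diffeomorphism and carries homogeneity over.
   Transitivity on observers is obtained from products of two reflections, which
   lie in the identity component because the mirror vectors are joined by a
   segment of non-null vectors. *)
Require Import Defs.
From mathcomp Require Import all_boot all_order all_algebra.
From mathcomp Require Import all_classical all_reals all_analysis.
From mathcomp Require Import ring lra.

Set Implicit Arguments.
Unset Strict Implicit.
Unset Printing Implicit Defensive.
Import Order.TTheory GRing.Theory Num.Theory.
Import numFieldNormedType.Exports.

Local Open Scope classical_set_scope.
Local Open Scope ring_scope.

(** * Linear algebra of the Minkowski form *)

Section Minkowski.
Variable R : realType.
Implicit Types (x y z s u v w : 'cV[R]_5) (a b r t : R) (A B g h : 'M[R]_5).

Lemma etaE x y : eta x y =
  - (x ord0 ord0 * y ord0 ord0) +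
  \sum_(i < 4) x (lift ord0 i) ord0 * y (lift ord0 i) ord0.
Proof.
rewrite /eta /eta_mx mxE big_ord_recl mul_mx_diag !mxE eqxx mulrN1 mulNr.
by congr (_ + _); apply: eq_bigr => i _; rewrite !mxE mulr1.
Qed.

Lemma etaC x y : eta x y = eta y x.
Proof.
rewrite !etaE mulrC; congr (_ + _).
by apply: eq_bigr => i _; rewrite mulrC.
Qed.

Lemma etaDl x y z : eta (x + y) z = eta x z + eta y z.
Proof. by rewrite /eta linearD /= !mulmxDl mxE. Qed.

Lemma etaZl a x y : eta (a *: x) y = a * eta x y.
Proof. by rewrite /eta linearZ /= -!scalemxAl mxE. Qed.

Lemma etaNl x y : eta (- x) y = - eta x y.
Proof. by rewrite -scaleN1r etaZl mulN1r. Qed.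

Lemma etaDr x y z : eta x (y + z) = eta x y + eta x z.
Proof. by rewrite /eta mulmxDr mxE. Qed.

Lemma etaZr a x y : eta x (a *: y) = a * eta x y.
Proof. by rewrite /eta -scalemxAr mxE. Qed.

Lemma etaNr x y : eta x (- y) = - eta x y.
Proof. by rewrite etaC etaNl etaC. Qed.

Lemma eta0r x : eta x 0 = 0.
Proof. by rewrite -(scale0r x) etaZr mul0r. Qed.

Definition eta_bilin :=
  (etaDl, etaDr, etaNl, etaNr, etaZl, etaZr).

Lemma eta_spatial_ge0 s : s ord0 ord0 = 0 -> 0 <= eta s s.
Proof.
move=> s0; rewrite etaE s0 mulr0 oppr0 add0r.
by apply: sumr_ge0 => i _; rewrite -expr2 sqr_ge0.
Qed.

Lemma eta_spatial_eq0 s : s ord0 ord0 = 0 -> eta s s = 0 -> s = 0.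
Proof.
move=> s0; rewrite etaE s0 mulr0 oppr0 add0r => /eqP.
rewrite psumr_eq0 => [/allP h|i _]; last by rewrite -expr2 sqr_ge0.
apply/colP => i; rewrite mxE; case: (unliftP ord0 i) => [j ->|->//].
by have := h j (mem_index_enum j); rewrite mulf_eq0 orbb => /eqP.
Qed.

Lemma timelike_time_neq0 u : eta u u < 0 -> u ord0 ord0 != 0.
Proof.
by move=> uu; apply/eqP => /eta_spatial_ge0; rewrite leNgt uu.
Qed.

(* Subtracting a multiple of u to kill the time component of s can only
   decrease eta s s. *)
Lemma eta_orth_timelike u s : eta u u < 0 -> eta u s = 0 ->
  0 <= eta s s /\ (eta s s = 0 -> s = 0).
Proof.
move=> uu us; have u0 := timelike_time_neq0 uu.
set k := s ord0 ord0 / u ord0 ord0.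
have p0 : (s - k *: u) ord0 ord0 = 0 by rewrite !mxE /k divfK // subrr.
have E : eta (s - k *: u) (s - k *: u) = eta s s + k ^+ 2 * eta u u.
  by rewrite !eta_bilin (etaC s u) us; ring.
have k2 : k ^+ 2 * eta u u <= 0 by rewrite mulr_ge0_le0 ?sqr_ge0 // ltW.
have := eta_spatial_ge0 p0; rewrite E => ge0; split; first by lra.
move=> ss; have /eqP : k ^+ 2 * eta u u = 0 by lra.
rewrite mulf_eq0 sqrf_eq0 (lt_eqF uu) orbF => /eqP k0.
apply: eta_spatial_eq0 => //; apply/eqP.
by move/eqP: k0; rewrite /k mulf_eq0 invr_eq0 (negPf u0) orbF.
Qed.

(** This combination cancels the time components, so [eta d d] is a Euclidean square; its sign gives
    Cauchy-Schwarz type facts about [eta x y]. *)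
Lemma eta_cross x y :
  let d := y ord0 ord0 *: x - x ord0 ord0 *: y in
  d ord0 ord0 = 0 /\
  eta d d = y ord0 ord0 ^+ 2 * eta x x + x ord0 ord0 ^+ 2 * eta y y
            - 2 * x ord0 ord0 * y ord0 ord0 * eta x y.
Proof.
split; first by rewrite !mxE; ring.
by rewrite !eta_bilin (etaC y x); ring.
Qed.

(** Non-negativity of the square in [eta_cross] bounds [2 * u0 * v0 * eta u v] by
    [- (u0 ^+ 2 + v0 ^+ 2)], with [u0], [v0] the positive time components. *)
Lemma eta_H4_lt0 u v : H4 u -> H4 v -> eta u v < 0.
Proof.
move=> [uu u0] [vv v0]; have [d0 dd] := eta_cross u v.
have := eta_spatial_ge0 d0; rewrite dd uu vv => h.
have := mulr_gt0 u0 v0; have := exprn_gt0 2 u0; have := exprn_gt0 2 v0.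
by nra.
Qed.

Lemma null_time_neq0 v : eta v v = 0 -> v != 0 -> v ord0 ord0 != 0.
Proof. by move=> vv; apply: contra_neq => v0; exact: eta_spatial_eq0. Qed.

(** If two null vectors were orthogonal, the vector of [eta_cross] would be spatial of norm zero,
    hence zero, making them proportional. *)
Lemma eta_null_neq0 v w : eta v v = 0 -> eta w w = 0 -> v != 0 -> w != 0 ->
  <[v]>%VS <> <[w]>%VS -> eta v w != 0.
Proof.
move=> vv ww vn0 wn0 vw; apply/eqP => evw; apply: vw.
have v0 := null_time_neq0 vv vn0; have w0 := null_time_neq0 ww wn0.
have [d0] := eta_cross v w; rewrite vv ww evw !mulr0 addr0 subr0.
move=> /(eta_spatial_eq0 d0)/eqP; rewrite subr_eq0 => /eqP e.
apply/eqP; rewrite eqEsubv -!memvE; apply/andP; split; apply/vlineP.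
  exists (v ord0 ord0 / w ord0 ord0).
  by rewrite mulrC -scalerA -e scalerA mulVf ?scale1r.
exists (w ord0 ord0 / v ord0 ord0).
by rewrite mulrC -scalerA e scalerA mulVf ?scale1r.
Qed.

(** Two linear conditions on a space of dimension 5: a matrix with two columns has rank at most 2,
    so its left kernel is non-zero. *)
Lemma exists_orth x y : exists s, [/\ s != 0, eta x s = 0 & eta y s = 0].
Proof.
pose M : 'M[R]_(5, 1 + 1) := eta_mx R *m row_mx x y.
have : kermx M != 0.
  rewrite kermx_eq0 /row_free; apply/eqP => rM.
  by have := rank_leq_col M; rewrite rM.
case/rowV0Pn => s /sub_kermxP sM s0; exists s^T; split.
- by rewrite -(inj_eq (@trmx_inj _ _ _)) trmxK trmx0.
- rewrite etaC /eta trmxK -mulmxA; move: sM.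
  by rewrite /M mul_mx_row mul_mx_row -[0]row_mx0 => /eq_row_mx[-> _]; rewrite mxE.
- rewrite etaC /eta trmxK -mulmxA; move: sM.
  by rewrite /M mul_mx_row mul_mx_row -[0]row_mx0 => /eq_row_mx[_ ->]; rewrite mxE.
Qed.

Lemma isometry_gram A : isometries A -> A^T *m eta_mx R *m A = eta_mx R.
Proof.
move=> iA; apply/matrixP => i j.
have E (M : 'M[R]_5) : ((delta_mx i ord0 : 'cV_5)^T *m M *m
    (delta_mx j ord0 : 'cV_5)) ord0 ord0 = M i j.
  by rewrite trmx_delta -rowE -colE !mxE.
rewrite -E -[RHS]E -/(eta _ _) -iA /eta trmx_mul.
by rewrite !mulmxA.
Qed.

(** Since [eta_mx] squares to the identity, the Gram identity exhibits [eta_mx *m A^T *m eta_mx] as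
    a left inverse. *)
Lemma isometry_unit A : isometries A -> A \in unitmx.
Proof.
move=> /isometry_gram AA.
have JJ : eta_mx R *m eta_mx R = 1%:M.
  rewrite /eta_mx mulmx_diag -diag_const_mx; congr diag_mx.
  by apply/rowP => i; rewrite !mxE; case: ifP => _; rewrite ?mulrNN mulr1.
have : (eta_mx R *m A^T *m eta_mx R) *m A = 1%:M.
  by rewrite -!mulmxA (mulmxA A^T) AA.
by case/mulmx1_unit.
Qed.

End Minkowski.

(** * Limits of matrix-valued functions *)

Section MatrixLimits.
Variables (K : numFieldType) (T : Type) (F : set_system T).
Context {FF : Filter F}.

(** A neighbourhood of [M] contains a box of neighbourhoods of its finitely many entries. *)
Lemma cvg_mx m n (f : T -> 'M[K]_(m, n)) (M : 'M[K]_(m, n)) :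
  (forall i j, f t i j @[t --> F] --> M i j) -> f t @[t --> F] --> M.
Proof.
move=> fM A [B MB sBA]; apply: (@filterS _ F _ _ _ (fun t => sBA (f t))) => /=.
by apply: filter_forall => i; apply: filter_forall => j; exact: fM.
Qed.

Lemma cvg_mx_coord m n (f : T -> 'M[K]_(m, n)) (M : 'M[K]_(m, n)) i j :
  f t @[t --> F] --> M -> f t i j @[t --> F] --> M i j.
Proof.
move=> fM; apply: (@cvg_comp _ _ _ f (fun N : 'M[K]_(m, n) => N i j) F (nbhs M)) => //.
exact: coord_continuous.
Qed.

Lemma cvg_mulmx m n p (f : T -> 'M[K]_(m, n)) (g : T -> 'M[K]_(n, p))
    (M : 'M[K]_(m, n)) (N : 'M[K]_(n, p)) :
  f t @[t --> F] --> M -> g t @[t --> F] --> N ->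
  f t *m g t @[t --> F] --> M *m N.
Proof.
move=> fM gN; apply: cvg_mx => i j; rewrite mxE.
under eq_cvg do rewrite mxE.
apply: cvg_big => [|k _]; first exact: add_continuous.
by apply: cvgM; apply: cvg_mx_coord.
Qed.

Lemma cvg_trmx m n (f : T -> 'M[K]_(m, n)) (M : 'M[K]_(m, n)) :
  f t @[t --> F] --> M -> (f t)^T @[t --> F] --> M^T.
Proof.
move=> fM; apply: cvg_mx => i j; rewrite mxE.
under eq_cvg do rewrite mxE.
exact: cvg_mx_coord.
Qed.

End MatrixLimits.

(** * The identity component: closedness, products, time orientation, reflections *)

Section LorentzGroup.
Variable R : realType.
Implicit Types (x y z s u v w : 'cV[R]_5) (a b : 'cV[R]_5) (A B g h : 'M[R]_5).

Lemma cvg_eta (T : Type) (F : set_system T) {FF : Filter F}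
    (f g : T -> 'cV[R]_5) x y :
  f t @[t --> F] --> x -> g t @[t --> F] --> y ->
  eta (f t) (g t) @[t --> F] --> eta x y.
Proof.
move=> fx gy; rewrite /eta.
have h : (f t)^T *m eta_mx R *m g t @[t --> F] --> x^T *m eta_mx R *m y.
  apply: cvg_mulmx => //.
  by apply: cvg_mulmx; [exact: cvg_trmx | exact: cvg_cst].
exact: (cvg_mx_coord h).
Qed.

Lemma mulmxr_continuous m n p (N : 'M[R]_(n, p)) :
  continuous (fun M : 'M[R]_(m, n) => M *m N).
Proof.
move=> M; apply: (@cvg_mulmx _ _ (nbhs M) _ _ _ _ id (fun=> N)) => //.
exact: cvg_cst.
Qed.

Lemma mulmxl_continuous m n p (M : 'M[R]_(m, n)) :
  continuous (fun N : 'M[R]_(n, p) => M *m N).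
Proof.
move=> N; apply: (@cvg_mulmx _ _ (nbhs N) _ _ _ _ (fun=> M) id) => //.
exact: cvg_cst.
Qed.

Lemma closed_fun_eq (V : topologicalType) (f : V -> R) (c : R) :
  continuous f -> closed [set v | f v = c].
Proof.
move=> cf; apply: (@preimage_closed _ _ f [set r | r = c]).
  by move=> v _; exact: cf.
exact: closed_eq.
Qed.

Lemma closed_isometries : closed (@isometries R).
Proof.
have -> : @isometries R = \bigcap_(xy in [set: 'cV[R]_5 * 'cV[R]_5])
    [set A | eta (A *m xy.1) (A *m xy.2) = eta xy.1 xy.2].
  by rewrite predeqE => A; split=> [iA [x y] _|iA x y]; [exact: iA|exact: (iA (x, y))].
apply: closed_bigI => -[x y] _; apply: closed_fun_eq => A /=.
have h z : B *m z @[B --> A] --> A *m z by exact: mulmxr_continuous.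
exact: cvg_eta (h x) (h y).
Qed.

(** Homogeneity asks for stabilizers closed in the space of all matrices, so the group itself must
    be closed there. *)
Lemma closed_SOo41 : closed (@SOo41 R).
Proof. by apply: component_closed; exact: closed_isometries. Qed.

Lemma closed_fixer x : closed [set g | g *m x = x].
Proof.
have -> : [set g | g *m x = x] = \bigcap_(i in [set: 'I_5])
    [set g | (g *m x) i ord0 = x i ord0].
  rewrite predeqE => g; split=> [/= gx i _ /=|gx]; first by rewrite gx.
  by apply/colP => i; apply: gx.
apply: closed_bigI => i _; apply: closed_fun_eq => g.
have h : k *m x @[k --> g] --> g *m x by exact: mulmxr_continuous.
exact: cvg_mx_coord h.
Qed.

Lemma SOo41_isometry g : SOo41 g -> isometries g.
Proof. exact: connected_component_sub. Qed.

Lemma isometry1 : isometries (1%:M : 'M[R]_5).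
Proof. by move=> x y; rewrite !mul1mx. Qed.

Lemma isometryM g h : isometries g -> isometries h -> isometries (g *m h).
Proof. by move=> ig ih x y; rewrite -!mulmxA ig ih. Qed.

Lemma SOo41_1 : SOo41 (1%:M : 'M[R]_5).
Proof. exact/connected_component_refl/isometry1. Qed.

(** The left translate of the component by [g] is a connected set of isometries containing both [g]
    and [g *m h]. *)
Lemma SOo41_mul g h : SOo41 g -> SOo41 h -> SOo41 (g *m h).
Proof.
move=> Gg Gh; apply: (connected_component_trans Gg).
have : connected [set g *m k | k in @SOo41 R].
  apply: connected_continuous_connected; first exact: component_connected.
  by apply: continuous_subspaceT; exact: mulmxl_continuous.
move=> C; apply: (connected_component_max _ _ C).
- by exists 1%:M; [exact: SOo41_1 | rewrite mulmx1].
- move=> _ [k Gk <-]; apply: isometryM; exact: SOo41_isometry.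
- by exists h.
Qed.

(** The time component of [h *m u] is continuous in [h] and never vanishes, because [h *m u] is
    timelike; on a connected group it keeps its sign. *)
Lemma SOo41_H4 g u : SOo41 g -> H4 u -> H4 (g *m u).
Proof.
move=> Gg [uu u0]; have igu h : SOo41 h -> eta (h *m u) (h *m u) = -1.
  by move=> /SOo41_isometry ih; rewrite ih.
split; first exact: igu.
pose time h := (h *m u) ord0 ord0.
have /connected_intervalP I : connected (time @` @SOo41 R).
  apply: connected_continuous_connected; first exact: component_connected.
  apply: continuous_subspaceT => h.
  have hu : k *m u @[k --> h] --> h *m u by exact: mulmxr_continuous.
  exact: cvg_mx_coord hu.
rewrite ltNge; apply/negP => gu0.
(* Intermediate value between [time g <= 0] and [time 1%:M > 0]. *)
have [h Gh /eqP] : (time @` @SOo41 R) 0.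
  apply: (I (time g) (time 1%:M)).
  - by exists g.
  - by exists 1%:M => //; exact: SOo41_1.
  - by rewrite gu0 /time mul1mx ltW.
by apply/negP/timelike_time_neq0; rewrite igu // ltrN10.
Qed.

Definition reflection a : 'M[R]_5 :=
  1%:M - (2 / eta a a) *: (a *m (a^T *m eta_mx R)).

Lemma reflectionE a x : reflection a *m x = x - (2 * eta a x / eta a a) *: a.
Proof.
rewrite mulmxBl mul1mx -scalemxAl -!mulmxA (mulmxA a^T).
rewrite [a^T *m _ *m x]mx11_scalar -/(eta a x) mul_mx_scalar scalerA.
by rewrite mulrAC.
Qed.

Lemma reflection_isometry a : eta a a != 0 -> isometries (reflection a).
Proof.
by move=> aa x y; rewrite !reflectionE !eta_bilin (etaC x a); field.
Qed.

Lemma reflectionK a : eta a a != 0 -> reflection a *m reflection a = 1%:M.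
Proof.
move=> aa; apply/matrixP => i j.
have E (M : 'M[R]_5) : (M *m (delta_mx j ord0 : 'cV_5)) i ord0 = M i j.
  by rewrite -colE mxE.
rewrite -E -[RHS]E -mulmxA; congr (fun_of_matrix _ i ord0).
rewrite mul1mx !reflectionE; set d : 'cV_5 := delta_mx j ord0.
have -> : eta a (d - (2 * eta a d / eta a a) *: a) = - eta a d.
  by rewrite !eta_bilin; field.
by rewrite mulrN mulNr scaleNr opprK subrK.
Qed.

Lemma cvg_reflection (T : Type) (F : set_system T) {FF : Filter F}
    (f : T -> 'cV[R]_5) a :
  eta a a != 0 -> f t @[t --> F] --> a ->
  reflection (f t) @[t --> F] --> reflection a.
Proof.
move=> aa fa; apply: cvgB; first exact: cvg_cst.
apply: cvgZ.
  by apply: cvgM; [exact: cvg_cst | apply: cvgV => //; exact: cvg_eta].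
apply: cvg_mulmx => //; apply: cvg_mulmx; last exact: cvg_cst.
exact: cvg_trmx.
Qed.

(** Sliding the first mirror vector along [a + t *: b] gives a path of isometries that starts at the
    identity, as [reflection a] is an involution. *)
Lemma SOo41_reflections a b :
  (forall t : R, 0 <= t <= 1 -> eta (a + t *: b) (a + t *: b) != 0) ->
  SOo41 (reflection (a + b) *m reflection a).
Proof.
move=> nz; pose p (t : R) := reflection (a + t *: b) *m reflection a.
have a0 : eta a a != 0 by have := nz 0; rewrite scale0r addr0; apply; rewrite lexx ler01.
have : connected (p @` `[0, 1]).
  apply: connected_continuous_connected; first exact: segment_connected.
  apply: continuous_in_subspaceT => t; rewrite inE /= in_itv /= => t01.
  apply: cvg_mulmx; last exact: cvg_cst.
  apply: cvg_reflection; first exact: nz.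
  apply: cvgD; first exact: cvg_cst.
  by apply: cvgZ; [exact: (@cvg_id _ (nbhs t)) | exact: cvg_cst].
move=> C; apply: (connected_component_max _ _ C).
- exists 0; first by rewrite /= in_itv /= lexx ler01.
  by rewrite /p scale0r addr0 reflectionK.
- move=> _ [t /= + <-]; rewrite in_itv /= => t01.
  by apply: isometryM; apply: reflection_isometry => //; exact: nz.
- by exists 1; rewrite /p ?scale1r //= in_itv /= lexx ler01.
Qed.

End LorentzGroup.

(** * Equivariant maps and the quotient manifold structure *)

Section Transfer.
Variables (R : realType) (X Y : Gspace R) (phi : gtype X -> gtype Y).
Hypotheses (homX : homogeneous X)
  (phiXY : forall x, gcar X x -> gcar Y (phi x)) (phi_equiv : equivariant phi).

Lemma equivariant_orbit_preimage x (V : set (gtype Y)) : gcar X x ->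
  orbit_preimage x (gcar X `&` phi @^-1` V) = orbit_preimage (phi x) V.
Proof.
move=> Xx; rewrite predeqE => g; split=> [[Gg [_ /= Vg]]|[Gg Vg]].
  by split; rewrite // -phi_equiv.
by split=> //; split; [exact: hom_stable | rewrite /= phi_equiv].
Qed.

Lemma equivariant_smooth : smooth_map phi.
Proof.
move=> V f [VY oV] sf; split; [split=> [x []//|x Xx]|move=> x Xx];
  rewrite equivariant_orbit_preimage //; first exact/oV/phiXY.
move=> g Dg; have [U [F [oU Ug sF FE]]] := sf _ (phiXY Xx) g Dg.
exists U, F; split=> // h Uh Dh; rewrite -FE //=.
by rewrite phi_equiv //; case: Dh.
Qed.

Hypotheses (phi_inj : forall x y, gcar X x -> gcar X y -> phi x = phi y -> x = y)
  (phi_surj : forall y, gcar Y y -> exists2 x, gcar X x & phi x = y).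

Lemma homogeneous_transfer : homogeneous Y.
Proof.
(* Injectivity makes the stabilizers of [x] and [phi x] coincide, so closedness carries over. *)
have fixE x : gcar X x -> [set g : 'M[R]_5 | SOo41 g /\ gact g (phi x) = phi x]
    = [set g | SOo41 g /\ gact g x = x].
  move=> Xx; rewrite predeqE => g; split=> -[Gg gx]; split=> //.
    by apply: phi_inj => //; [exact: hom_stable | rewrite phi_equiv].
  by rewrite -phi_equiv // gx.
split.
- by have [x Xx] := hom_nonempty homX; exists (phi x); exact: phiXY.
- move=> g y Gg /phi_surj[x Xx <-]; rewrite -phi_equiv //.
  by apply/phiXY/hom_stable.
- by move=> y /phi_surj[x Xx <-]; rewrite -phi_equiv ?hom_act1 //; exact: SOo41_1.
- move=> g h y Gg Gh /phi_surj[x Xx <-].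
  rewrite -phi_equiv ?hom_actM //; last exact: SOo41_mul.
  by rewrite !phi_equiv //; exact: hom_stable.
- move=> y z /phi_surj[x Xx <-] /phi_surj[x' Xx' <-].
  have [g Gg gx] := hom_transitive homX Xx Xx'.
  by exists g => //; rewrite -phi_equiv // gx.
- by move=> y /phi_surj[x Xx <-]; rewrite fixE //; exact: hom_closed_stab.
Qed.

End Transfer.

(** The inverse is again equivariant and [Y] is homogeneous by transfer, so [equivariant_smooth]
    applies in both directions. *)
Lemma Gspace_isomorphic_bij (R : realType) (X Y : Gspace R)
    (phi : gtype X -> gtype Y) :
  homogeneous X -> (forall x, gcar X x -> gcar Y (phi x)) -> equivariant phi ->
  (forall x y, gcar X x -> gcar X y -> phi x = phi y -> x = y) ->
  (forall y, gcar Y y -> exists2 x, gcar X x & phi x = y) ->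
  Gspace_isomorphic X Y.
Proof.
move=> homX phiXY phi_equiv phi_inj phi_surj.
have [x0 _] := hom_nonempty homX.
have /choice[psi psiP] y : exists x, gcar Y y -> gcar X x /\ phi x = y.
  have [/phi_surj[x Xx xy]|?] := pselect (gcar Y y); first by exists x.
  (* [x0] is the default value of [psi] outside [gcar Y]. *)
  by exists x0.
have psiK x : gcar X x -> psi (phi x) = x.
  by move=> Xx; have [? ?] := psiP _ (phiXY _ Xx); exact: phi_inj.
have homY := homogeneous_transfer homX phiXY phi_equiv phi_inj phi_surj.
exists phi; split=> //; exists psi; split=> //.
- by move=> x Xx; split; [exact: phiXY | exact: psiK].
- exact: equivariant_smooth.
- apply: equivariant_smooth => // [y /psiP[]//|g y Gg Yy].
  have [Xp <-] := psiP _ Yy; rewrite -phi_equiv // !psiK //.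
  exact: hom_stable.
Qed.

(** * Homogeneity of the observer space *)

Section Observers.
Variable R : realType.
Implicit Types (x y z s u v w : 'cV[R]_5) (r t : R) (g : 'M[R]_5).

(** The first reflection sends [x] to [- x]; as [x] and [y] have equal norms, the mirror vector
    [x + y] is orthogonal to [x - y], and the second sends [- x] to [y]. *)
Lemma reflections_transport x y : eta x x = eta y y -> eta x x != 0 ->
  eta (x + y) (x + y) != 0 -> (reflection (x + y) *m reflection x) *m x = y.
Proof.
move=> xy xx pp; rewrite -mulmxA.
have -> : reflection x *m x = - x.
  by rewrite reflectionE -mulrA divff // mulr1 scaler_nat mulr2n opprD addNKr.
rewrite reflectionE.
have -> : 2 * eta (x + y) (- x) / eta (x + y) (x + y) = -1.
  have E : eta (x + y) (x + y) = 2 * eta (x + y) x.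
    by rewrite !eta_bilin -xy (etaC y x); ring.
  by rewrite etaNr mulrN -E mulNr divff.
by rewrite scaleN1r opprK addKr.
Qed.

Lemma SOo41_H4_transitive u v : H4 u -> H4 v ->
  exists2 g, SOo41 g & g *m u = v.
Proof.
move=> Hu Hv; have uv := eta_H4_lt0 Hu Hv; have [uu _] := Hu; have [vv _] := Hv.
have nz t : 0 <= t <= 1 -> eta (u + t *: v) (u + t *: v) != 0.
  move=> /andP[t0 _]; apply: ltr0_neq0.
  by rewrite !eta_bilin uu vv (etaC v u); nra.
exists (reflection (u + v) *m reflection u); first exact: SOo41_reflections.
apply: reflections_transport; first by rewrite uu vv.
  by rewrite uu oppr_eq0 oner_eq0.
by have := nz 1; rewrite scale1r; apply; rewrite ler01 lexx.
Qed.

Lemma H4_timelike u : H4 u -> eta u u < 0.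
Proof. by move=> [-> _]; rewrite ltrN10. Qed.

(** All mirror vectors [x + t *: y] lie in the positive definite complement of [u], so the
    reflections fix [u], and only the antipodal case [y = - x] could produce a null mirror. *)
Lemma SOo41_fix_transport u x y : H4 u ->
  eta x x = 1 -> eta u x = 0 -> eta y y = 1 -> eta u y = 0 -> x + y != 0 ->
  exists g, [/\ SOo41 g, g *m u = u & g *m x = y].
Proof.
move=> Hu xx ux yy uy xy0.
have nz t : 0 <= t <= 1 -> eta (x + t *: y) (x + t *: y) != 0.
  move=> /andP[t0 _]; apply: contra_neq xy0 => p0.
  have uxy : eta u (x + t *: y) = 0 by rewrite !eta_bilin ux uy mulr0 addr0.
  have [_ /(_ p0)/eqP] := eta_orth_timelike (H4_timelike Hu) uxy.
  (* A null mirror gives [x = - (t *: y)]; unit norms and [0 <= t] then force [t = 1]. *)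
  rewrite addr_eq0 => /eqP xE; move: xx; rewrite xE !eta_bilin yy => t2.
  have -> : t = 1 by nra.
  by rewrite scale1r addNr.
have fixu s : eta u s = 0 -> reflection s *m u = u.
  by move=> us; rewrite reflectionE etaC us mulr0 mul0r scale0r subr0.
exists (reflection (x + y) *m reflection x); split.
- exact: SOo41_reflections.
- by rewrite -mulmxA !fixu // etaDr ux uy addr0.
- apply: reflections_transport; rewrite ?xx ?yy ?oner_eq0 //.
  by have := nz 1; rewrite scale1r; apply; rewrite ler01 lexx.
Qed.

Lemma exists_unit_orth u y : H4 u ->
  exists z, [/\ eta z z = 1, eta u z = 0 & eta y z = 0].
Proof.
move=> Hu; have [s [s0 us ys]] := exists_orth u y.
have [ss0 ssP] := eta_orth_timelike (H4_timelike Hu) us.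
have ss : 0 < eta s s.
  by rewrite lt_neqAle ss0 andbT eq_sym; apply: contra_neq s0 => /ssP.
exists ((Num.sqrt (eta s s))^-1 *: s); rewrite !eta_bilin us ys !mulr0; split=> //.
rewrite mulrA -invfM -expr2 sqr_sqrtr // mulVf //.
exact: lt0r_neq0.
Qed.

Lemma SOo41_fix_transitive u x y : H4 u ->
  eta x x = 1 -> eta u x = 0 -> eta y y = 1 -> eta u y = 0 ->
  exists g, [/\ SOo41 g, g *m u = u & g *m x = y].
Proof.
move=> Hu xx ux yy uy.
have [xy0|] := eqVneq (x + y) 0; last exact: SOo41_fix_transport.
(* The antipodal case goes in two quarter turns, through a unit vector [z] orthogonal to [u] and
   [x]. *)
have [z [zz uz xz]] := exists_unit_orth x Hu.
have xz0 : x + z != 0.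
  apply/eqP => e; have /eqP : eta x (x + z) = 0 by rewrite e eta0r.
  by rewrite etaDr xx xz addr0 oner_eq0.
have zy0 : z + y != 0.
  apply/eqP => e; have /eqP : eta z (z + y) = 0 by rewrite e eta0r.
  move/eqP: xy0; rewrite addrC addr_eq0 => /eqP ->.
  by rewrite etaDr etaNr zz (etaC z x) xz subr0 oner_eq0.
have [g [Gg gu gx]] := SOo41_fix_transport Hu xx ux zz uz xz0.
have [h [Gh hu hz]] := SOo41_fix_transport Hu zz uz yy uy zy0.
exists (h *m g); split; first exact: SOo41_mul.
  by rewrite -mulmxA gu hu.
by rewrite -mulmxA gx hz.
Qed.

Lemma H4_nonempty : exists u, H4 u.
Proof.
exists (delta_mx ord0 ord0); split; last by rewrite mxE eqxx ltr01.
rewrite etaE big1 => [|i _]; first by rewrite !mxE eqxx mulr1 addr0.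
by rewrite !mxE /= mul0r.
Qed.

Lemma homogeneous_observer_space : homogeneous (observer_space R).
Proof.
split=> /=.
- have [u Hu] := H4_nonempty; have [x [xx ux _]] := exists_unit_orth 0 Hu.
  by exists (x, u); split=> //=; rewrite etaC.
- move=> g [x u] Gg [/= xx Hu xu]; have ig := SOo41_isometry Gg.
  by split; rewrite /= ?ig //; [rewrite /deSitter /= ig | exact: SOo41_H4].
- by move=> [x u] _ /=; rewrite !mul1mx.
- by move=> g h [x u] _ _ _ /=; rewrite !mulmxA.
- move=> [x u] [y v] [/= xx Hu xu] [/= yy Hv yv].
  (* First move the velocity [u] to [v], then adjust the position by an element fixing [v]. *)
  have [g Gg gu] := SOo41_H4_transitive Hu Hv; have ig := SOo41_isometry Gg.
  have gxx : eta (g *m x) (g *m x) = 1 by rewrite ig.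
  have vgx : eta v (g *m x) = 0 by rewrite -gu ig etaC.
  have [h [Gh hv hx]] := SOo41_fix_transitive Hv gxx vgx yy (etrans (etaC v y) yv).
  exists (h *m g); first exact: SOo41_mul.
  by rewrite -!mulmxA gu hv hx.
- move=> [x u] _ /=.
  have -> : [set g : 'M[R]_5 | SOo41 g /\ (g *m x, g *m u) = (x, u)] =
    @SOo41 R `&` ([set g | g *m x = x] `&` [set g | g *m u = u]).
    rewrite predeqE => g; split=> [[Gg [gx gu]]|[Gg [/= gx gu]]] //.
    by rewrite gx gu.
  by apply: closedI; [exact: closed_SOo41 | apply: closedI; exact: closed_fixer].
Qed.

End Observers.

(** * Centered spheres and the bijection with observers *)

Section Spheres.
Variable R : realType.
Implicit Types (x y z s u v w : 'cV[R]_5) (a b r t : R) (g : 'M[R]_5).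

Lemma vlineZ a v : a != 0 -> <[a *: v]>%VS = <[v]>%VS.
Proof.
move=> a0; apply/eqP; rewrite eqEsubv -!memvE memvZ ?memv_line //=.
by apply/vlineP; exists a^-1; rewrite scalerA mulVf ?scale1r.
Qed.

Lemma vline_eqP v w : v != 0 -> <[v]>%VS = <[w]>%VS ->
  exists2 a, a != 0 & v = a *: w.
Proof.
move=> v0 vw; have /vlineP[a va] : v \in <[w]>%VS by rewrite -vw memv_line.
by exists a => //; apply: contra_neq v0 => a0; rewrite va a0 scale0r.
Qed.

Lemma act_line_vline g v : act_line g <[v]>%VS = <[g *m v]>%VS.
Proof. by rewrite /act_line limg_line lfunE. Qed.

Lemma act_line_sphere g v w r : isometries g ->
  act_line g @` sphere_of v w r = sphere_of (g *m v) (g *m w) r.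
Proof.
move=> ig; have gU := isometry_unit ig.
have chartE s : act_line g (conf_chart v w s) =
    conf_chart (g *m v) (g *m w) (g *m s).
  by rewrite act_line_vline mulmxBr mulmxDr -scalemxAr /conf_chart !ig.
rewrite predeqE => p; split=> [[_ [s [[vs ws] ss] <-] <-]|[s [[vs ws] ss] <-]].
  by exists (g *m s); [rewrite /= /W_perp /= !ig | rewrite chartE].
have gs : g *m (invmx g *m s) = s by rewrite mulmxA mulmxV ?mul1mx.
exists (conf_chart v w (invmx g *m s)); last by rewrite chartE gs.
exists (invmx g *m s) => //; rewrite /= /W_perp /=.
by rewrite -(ig v) -(ig w) -(ig (invmx g *m s)) gs.
Qed.

(** Substituting [a *: s] for [s] multiplies the spanning vector by [a]; the factor [b] cancels
    between [w] and [eta v w]. *)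
Lemma sphere_ofZ a b v w r : a != 0 -> b != 0 -> eta v w != 0 ->
  sphere_of (a *: v) (b *: w) r = sphere_of v w (r / a).
Proof.
move=> a0 b0 vw.
have chartE s : conf_chart (a *: v) (b *: w) (a *: s) = conf_chart v w s.
  rewrite /conf_chart -(vlineZ (v + s - _) a0) !eta_bilin scalerBr scalerDr.
  by rewrite !scalerA; congr (<[_ - _ *: _]>%VS); field; rewrite a0 b0 vw.
rewrite predeqE => p; split=> -[s [[/= vs ws] ss] <-].
  exists (a^-1 *: s); last by rewrite -chartE scalerA divff ?scale1r.
  move/eqP: vs; move/eqP: ws; rewrite !etaZl !mulf_eq0 (negPf a0) (negPf b0) /=.
  move=> /eqP ws /eqP vs; rewrite /= /W_perp /= !eta_bilin vs ws ss !mulr0.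
  by split=> //; field.
exists (a *: s) => //; rewrite /= /W_perp /= !eta_bilin vs ws ss !mulr0.
by split=> //; field.
Qed.

(** Makes the radius readable from any point of a sphere: pairing the spanning vectors with [w]
    shows that they are equal, and pairing with [v] then compares the norms. *)
Lemma conf_chart_norm v w s s' : eta v v = 0 -> eta w w = 0 ->
  eta v w != 0 -> W_perp v w s -> W_perp v w s' ->
  conf_chart v w s = conf_chart v w s' -> eta s s = eta s' s'.
Proof.
move=> vv ww vw [vs ws] [vs' ws'] E.
set c := eta s s / (2 * eta v w); set c' := eta s' s' / (2 * eta v w).
have : v + s - c *: w \in <[v + s' - c' *: w]>%VS.
  by rewrite -/(conf_chart v w s') -E memv_line.
case/vlineP => k kE.
have k1 : k = 1.
  have := congr1 (eta w) kE; rewrite !eta_bilin ww ws ws' (etaC w v).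
  rewrite !mulr0 !addr0 !subr0 => /eqP.
  by rewrite -{1}[eta v w]mul1r (inj_eq (mulIf vw)) => /eqP.
have := congr1 (eta v) kE; rewrite k1 scale1r !eta_bilin vv vs vs' !add0r.
move=> /oppr_inj/(mulIf vw); apply: mulIf.
by rewrite invr_eq0 mulf_neq0 ?pnatr_eq0.
Qed.

Definition celestial_sphere (xu : 'cV[R]_5 * 'cV[R]_5) :=
  (<[xu.2 + xu.1]>%VS, <[xu.2 - xu.1]>%VS,
   sphere_of (xu.2 + xu.1) (xu.2 - xu.1) 2).

Lemma observer_null x u : observers (x, u) ->
  [/\ eta (u + x) (u + x) = 0, eta (u - x) (u - x) = 0
    & eta (u + x) (u - x) = - 2].
Proof.
by move=> [/= xx [uu _] xu]; rewrite !eta_bilin xx uu (etaC u x) xu; split; ring.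
Qed.

Lemma null_pair_neq0 v w : eta v w = - 2 -> v != 0 /\ w != 0.
Proof.
move=> vw; have n2 : - 2 != 0 :> R by rewrite oppr_eq0 pnatr_eq0.
split; apply: contra_neq n2 => e0; rewrite -vw e0; first by rewrite etaC eta0r.
by rewrite eta0r.
Qed.

Lemma PC_vline v : v != 0 -> eta v v = 0 -> PC <[v]>%VS.
Proof.
move=> v0 vv; split; first by rewrite dim_vline v0.
by move=> _ /vlineP[k ->]; rewrite !eta_bilin vv !mulr0.
Qed.

Lemma celestial_sphere_pointed xu :
  observers xu -> pointed_spheres (celestial_sphere xu).
Proof.
case: xu => x u Oxu; have [vv ww vw] := observer_null Oxu.
have [v0 w0] := null_pair_neq0 vw.
split; rewrite /=; [exact: PC_vline|exact: PC_vline| |].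
  move=> /(vline_eqP v0)[k _ vE]; move/eqP: vw.
  by rewrite vE etaZl ww mulr0 eq_sym oppr_eq0 pnatr_eq0.
by exists (u + x), (u - x), 2; split.
Qed.

Lemma celestial_sphere_equiv g xu : SOo41 g ->
  celestial_sphere (g *m xu.1, g *m xu.2) =
  gact (g := sphere_space R) g (celestial_sphere xu).
Proof.
move=> /SOo41_isometry ig.
by rewrite /celestial_sphere /= act_line_sphere // !act_line_vline mulmxBr mulmxDr.
Qed.

(** Equal lines make the null vectors of the two observers differ by factors [a] and [b]. The
    product [- 2] gives [a * b = 1], time orientation gives [a > 0], and the radius gives
    [a = 1]. *)
Lemma celestial_sphere_inj xu yv : observers xu -> observers yv ->
  celestial_sphere xu = celestial_sphere yv -> xu = yv.
Proof.
case: xu yv => [x u] [y v] Oxu Oyv; rewrite /celestial_sphere /=.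
have [pp qq pq] := observer_null Oxu; have [pp' qq' pq'] := observer_null Oyv.
have [p0 q0] := null_pair_neq0 pq; have [p0' q0'] := null_pair_neq0 pq'.
move=> /pair_equal_spec[/pair_equal_spec[/esym pE /esym qE] SE].
have {pE} [a a0 pE] := vline_eqP p0' pE; have {qE} [b b0 qE] := vline_eqP q0' qE.
have ab : a * b = 1.
  move/eqP: pq'; rewrite pE qE etaZl etaZr pq mulrA -subr_eq0.
  rewrite (_ : _ - _ = 2 * (1 - a * b)); last by ring.
  by rewrite mulf_eq0 pnatr_eq0 subr_eq0 => /eqP.
have [_ Hu xu0] := Oxu; have [_ Hv _] := Oyv; rewrite /= in Hu Hv xu0.
have vE : 2 *: v = a *: (u + x) + b *: (u - x).
  by rewrite scaler_nat mulr2n -pE -qE addrACA subrr addr0.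
have yE : 2 *: y = a *: (u + x) - b *: (u - x).
  by rewrite scaler_nat mulr2n -pE -qE opprB [RHS]addrC addrA addrNK.
have ab_gt0 : 0 < a + b.
  have vu := eta_H4_lt0 Hv Hu; have [uu _] := Hu.
  (* Pairing with [u] gives [2 * eta v u = - (a + b)], and [eta v u] is negative. *)
  have := congr1 (fun z => eta z u) vE; rewrite /= !eta_bilin uu xu0 => e.
  lra.
have a_gt0 : 0 < a by nra.
have pq0 : eta (u + x) (u - x) != 0 by rewrite pq oppr_eq0 pnatr_eq0.
rewrite pE qE sphere_ofZ // in SE.
have [s [ss us xs]] := exists_unit_orth x Hu.
(* A sample point of the first sphere; it also lies on the sphere of radius [2 / a], so the two
   radii agree. *)
have : sphere_of (u + x) (u - x) 2 (conf_chart (u + x) (u - x) (2 *: s)).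
  exists (2 *: s) => //; rewrite /= /W_perp /= !eta_bilin us xs ss.
  by split; [split|]; ring.
rewrite SE => -[s' [Ws' ss'] /esym E].
have Ws : W_perp (u + x) (u - x) (2 *: s).
  by rewrite /W_perp /= !eta_bilin us xs; split; ring.
have := conf_chart_norm pp qq pq0 Ws Ws' E; rewrite ss' !eta_bilin ss mulr1 -expr2.
move=> /eqP; rewrite eqrXn2 ?ler0n // ?divr_ge0 ?ler0n ?(ltW a_gt0) //.
move=> /eqP a1.
have {}a1 : a = 1.
  have : 2 = 2 * a by rewrite {2}a1 divfK.
  lra.
have b1 : b = 1 by rewrite -ab a1 mul1r.
have two0 : 2 != 0 :> R by rewrite pnatr_eq0.
have -> : x = y.
  apply: (scalerI two0); rewrite yE a1 b1 !scale1r opprB addrC addrA addrNK.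
  by rewrite scaler_nat mulr2n.
have -> // : u = v.
by apply: (scalerI two0); rewrite vE a1 b1 !scale1r addrACA subrr addr0 scaler_nat mulr2n.
Qed.

(** Inverse construction: [a *: v] and [b *: w] become [u + x] and [u - x]. The sign of [a] is left
    open so that both time orientations can be tried. *)
Lemma celestial_sphere_null v w a b (u := 2^-1 *: (a *: v + b *: w))
    (x := 2^-1 *: (a *: v - b *: w)) :
  eta v v = 0 -> eta w w = 0 -> a * b * eta v w = - 2 -> 0 < u ord0 ord0 ->
  observers (x, u) /\
  celestial_sphere (x, u) = (<[v]>%VS, <[w]>%VS, sphere_of v w (2 / a)).
Proof.
move=> vv ww abvw u0; have two0 : 2 != 0 :> R by rewrite pnatr_eq0.
have /[!mulf_eq0] /norP[/norP[a0 b0] vw] : a * b * eta v w != 0.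
  by rewrite abvw oppr_eq0.
have ux : u + x = a *: v.
  rewrite -scalerDr addrACA subrr addr0 -mulr2n.
  by rewrite -[(a *: v) *+ 2]scaler_nat scalerK ?unitfE.
have u_x : u - x = b *: w.
  rewrite -scalerBr opprB addrC addrA addrNK -mulr2n.
  by rewrite -[(b *: w) *+ 2]scaler_nat scalerK ?unitfE.
split; last by rewrite /celestial_sphere /= ux u_x !vlineZ // sphere_ofZ.
have wv := etaC w v.
split; rewrite /deSitter /H4 /= /u /x ?eta_bilin vv ww ?wv.
- by lra.
- by split=> //; lra.
- by lra.
Qed.

Lemma celestial_sphere_surj T : @pointed_spheres R T ->
  exists2 xu, observers xu & celestial_sphere xu = T.
Proof.
case: T => [[p q] S] [/= [_ pnull] [_ qnull] pq [v [w [r [[v0 w0] pE qE r0 ->]]]]].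
subst p q; have vv := pnull v (memv_line v); have ww := qnull w (memv_line w).
have vw := eta_null_neq0 vv ww v0 w0 pq.
pose a := 2 / r; pose b := - 2 / (a * eta v w).
have a0 : a != 0 by rewrite mulf_neq0 ?invr_eq0 ?pnatr_eq0 ?lt0r_neq0.
have ra : 2 / a = r by rewrite /a invf_div mulrC divfK ?pnatr_eq0.
have abvw : a * b * eta v w = - 2 by rewrite /b; field; rewrite a0 vw.
pose u := 2^-1 *: (a *: v + b *: w).
have u0 : u ord0 ord0 != 0.
  apply: timelike_time_neq0; rewrite !eta_bilin vv ww (etaC w v).
  set e := (X in X < 0); have -> : e = -1 by rewrite /e; lra.
  by rewrite ltrN10.
case: (ltgtP (u ord0 ord0) 0) => [un|up|/eqP]; last by rewrite (negPf u0).
(* Negating both factors turns [u] into [- u]; the radius becomes [- r], but [sphere_of] sees only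
   its square. *)
- have abvwN : - a * - b * eta v w = - 2 by rewrite mulrNN.
  have uN : 2^-1 *: (- a *: v + - b *: w) = - u.
    by rewrite !scaleNr -opprD scalerN.
  have [|Oxu xuE] := celestial_sphere_null vv ww abvwN.
    by rewrite uN mxE oppr_gt0.
  eexists; first exact: Oxu.
  by rewrite xuE /sphere_of invrN mulrN sqrrN ra.
- have [Oxu xuE] := celestial_sphere_null vv ww abvw up.
  by eexists; [exact: Oxu | rewrite xuE ra].
Qed.

End Spheres.

Theorem proposition2 (R : realType) :
  [/\ homogeneous (observer_space R),
      homogeneous (sphere_space R) &
      Gspace_isomorphic (observer_space R) (sphere_space R)].
Proof.
have homO := homogeneous_observer_space R.
have maps : forall xu, gcar (observer_space R) xu ->
  gcar (sphere_space R) (celestial_sphere xu) := @celestial_sphere_pointed R.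
have equiv : equivariant (X := observer_space R) (Y := sphere_space R)
  (@celestial_sphere R) by move=> g xu Gg _; exact: celestial_sphere_equiv.
split=> //.
- exact: (homogeneous_transfer homO maps equiv (@celestial_sphere_inj R)
    (@celestial_sphere_surj R)).
- exact: (Gspace_isomorphic_bij homO maps equiv (@celestial_sphere_inj R)
    (@celestial_sphere_surj R)).
Qed.
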